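(* Let $G$ and $H$ be transitive permutation groups on finite sets $\Gamma$ and $\Delta$ respectively, and let $G\wr H$ have its imprimitive action on $\Omega=\Gamma\times\Delta$, with canonical partition $\Pi$. If $\Sigma$ is any $(G\wr H)$-invariant partition of $\Omega$, then either $\Sigma\preceq\Pi$ or $\Pi\preceq\Sigma$.
   Context: For $\delta\in\Delta$ put $\Gamma_\delta=\{(\gamma,\delta):\gamma\in\Gamma\}$. The canonical partition $\Pi$ of $\Gamma\times\Delta$ is the partition into the sets $\Gamma_\delta$, $\delta\in\Delta$. The wreath product $G\wr H$ in its imprimitive action is the permutation group on $\Gamma\times\Delta$ generated by: the base group, i.e. the direct product of copies $G_\delta$ of $G$ indexed by $\delta\in\Delta$, where $G_\delta$ acts on $\Gamma_\delta$ as $G$ acts on $\Gamma$ and fixes all points outside $\Gamma_\delta$; and the top group, a copy of $H$ acting on the second coordinate. A partition is invariant under a group if every group element maps each part onto a part. For partitions, $\Pi\preceq\Sigma$ ($\Pi$ refines $\Sigma$) means that every part of $\Sigma$ is a union of parts of $\Pi$. *)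

(* Defs.v *)
From mathcomp Require Import all_boot all_fingroup.

Set Implicit Arguments.
Unset Strict Implicit.
Unset Printing Implicit Defensive.

Local Open Scope group_scope.

Section Partitions.

Variable T : finType.

(* 'P^* sends a part B to its image under the permutation. *)
Definition invariant_partition (A : {set {perm T}}) (P : {set {set T}}) : Prop :=
  partition P [set: T] /\ [acts A, on P | 'P^*].

Definition refines (P Q : {set {set T}}) : Prop :=
  forall B : {set T}, B \in Q ->
    exists C : {set {set T}}, C \subset P /\ B = cover C.

End Partitions.

Section Wreath.

Variables Gamma Delta : finType.

Definition fibre (d : Delta) : {set Gamma * Delta} :=
  [set (c, d) | c in [set: Gamma]].

Definition canonical_partition : {set {set Gamma * Delta}} :=
  [set fibre d | d in [set: Delta]].

Definition base_fun (d : Delta) (g : {perm Gamma}) (x : Gamma * Delta) :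
    Gamma * Delta :=
  if x.2 == d then (g x.1, x.2) else x.

Lemma base_fun_inj d g : injective (base_fun d g).
Proof.
move=> [a i] [b j]; rewrite /base_fun /=.
by case: (i =P d) => [->|?]; case: (j =P d) => [->|?] // -[];
  [move=> /perm_inj->|congruence..].
Qed.

Definition base_perm d g : {perm Gamma * Delta} := perm (@base_fun_inj d g).

Definition top_fun (h : {perm Delta}) (x : Gamma * Delta) : Gamma * Delta :=
  (x.1, h x.2).

Lemma top_fun_inj h : injective (top_fun h).
Proof. by move=> [a i] [b j] [-> /perm_inj->]. Qed.

Definition top_perm h : {perm Gamma * Delta} := perm (@top_fun_inj h).

Lemma base_permM d : {morph base_perm d : g1 g2 / g1 * g2}.
Proof.
move=> g1 g2; apply/permP => x; rewrite permM !permE /base_fun.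
by case: (x.2 =P d) => [/= ->|/eqP/negPf->]; rewrite ?eqxx ?permM.
Qed.

Lemma top_permM : {morph top_perm : h1 h2 / h1 * h2}.
Proof. by move=> h1 h2; apply/permP => x; rewrite permM !permE /top_fun /= permM. Qed.

Canonical base_morphism d := @Morphism _ _ setT (base_perm d)
  (fun g1 g2 _ _ => base_permM d g1 g2).
Canonical top_morphism := @Morphism _ _ setT top_perm
  (fun h1 h2 _ _ => top_permM h1 h2).

Variables (G : {group {perm Gamma}}) (H : {group {perm Delta}}).

Definition base_copy (d : Delta) : {group {perm Gamma * Delta}} :=
  (base_perm d @* G)%G.

(* In Group_scope \prod is the subgroup generated by the factors; that it is their
   internal direct product is base_group_dprod. *)
Definition base_group : {group {perm Gamma * Delta}} :=
  (\prod_(d : Delta) base_copy d)%G.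

Definition top_group : {group {perm Gamma * Delta}} := (top_perm @* H)%G.

Definition wreath : {group {perm Gamma * Delta}} :=
  (base_group <*> top_group)%G.

Lemma base_group_dprod : \big[dprod/1]_(d : Delta) base_copy d = base_group.
Proof.
have off d u x : u \in (\prod_(j | j != d) base_copy j)%G -> x.2 = d -> u x = x.
  move=> uP xd.
  have /subsetP/(_ u uP) :
      (\prod_(j | j != d) base_copy j)%G \subset 'C(fibre d | 'P).
    rewrite bigprodGE gen_subG; apply/bigcupsP => j jd; apply/subsetP => v.
    case/morphimP => g _ _ ->; apply/astabP => _ /imsetP[c _ ->].
    by rewrite /= /aperm permE /base_fun /= eq_sym (negPf jd).
  move/astabP/(_ x); rewrite /= /aperm; apply.
  by apply/imsetP; exists x.1; rewrite ?inE // -xd -surjective_pairing.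
apply/eqP/bigdprodYP => d _; rewrite subsetD; apply/andP; split.
  rewrite bigprodGE gen_subG; apply/bigcupsP => j jd.
  apply/centsP => _ /morphimP[g _ _ ->] _ /morphimP[k _ _ ->].
  apply/permP => -[c i]; rewrite !permM !permE /base_fun /=.
  by have [->|ij] := eqVneq i j; rewrite ?(negPf jd) /= ?eqxx ?(negPf jd) //;
    case: eqP => //= _; rewrite (negPf ij).
rewrite -setI_eq0; apply/eqP/setP => u; rewrite !inE /=.
apply/negP => /and3P[uP u1 /morphimP[g _ _ def_u]]; case/eqP: u1.
apply/permP => x; rewrite perm1.
have [xd|xd] := eqVneq x.2 d; first exact: off uP xd.
by rewrite def_u permE /base_fun (negPf xd).
Qed.

End Wreath.

(* Main.v *)
Require Import Defs.
From mathcomp Require Import all_boot all_fingroup.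

(** Suppose that [Sigma] does not refine the canonical partition. Then some part
    [S] contains two points [(a, i)] and [(b, j)] with [i != j]. The copy of
    [G] on the fibre over [i] fixes [(b, j)], so it preserves [S]; being
    transitive on that fibre, it spreads [(a, i)] over all of it, and [S]
    contains the fibre ([fibre_sub_mixed_part]). As the top group permutes the
    fibres transitively, this holds of every fibre: it lies inside one part
    ([fibre_sub_part]). A part is therefore the union of the fibres that it
    meets. *)

Local Open Scope group_scope.

(** Refinement can be tested pointwise: the required union consists of all the
    parts of [P] that lie inside [B]. *)
Lemma refinesP (T : finType) (P Q : {set {set T}}) :
  (forall B x, B \in Q -> x \in B ->
     exists A : {set T}, [/\ A \in P, x \in A & A \subset B]) ->
  refines P Q.
Proof.
move=> PQ B QB; exists [set A in P | A \subset B]; split.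
  by apply/subsetP => A; rewrite inE => /andP[].
apply/setP => x; apply/idP/bigcupP => [Bx | [A]]; last first.
  by rewrite inE => /andP[_ /subsetP AB] /AB.
by have [A [PA Ax AB]] := PQ B x QB Bx; exists A; rewrite // inE PA.
Qed.

Lemma in_fibre (Gamma Delta : finType) (d : Delta) (x : Gamma * Delta) :
  (x \in fibre Gamma d) = (x.2 == d).
Proof.
apply/imsetP/eqP => [[c _ ->] // | <-].
by exists x.1; rewrite ?inE // -surjective_pairing.
Qed.

Section WreathParts.

Set Implicit Arguments.
Unset Strict Implicit.

Variables (Gamma Delta : finType).
Variables (G : {group {perm Gamma}}) (H : {group {perm Delta}}).

Lemma base_perm_wreath d g : g \in G -> base_perm d g \in wreath G H.
Proof.
move=> Gg; apply: (subsetP (joing_subl _ _)).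
rewrite /base_group bigprodGE; apply/mem_gen/bigcupP; exists d => //.
by apply: mem_morphim; rewrite ?inE.
Qed.

Lemma top_perm_wreath h : h \in H -> top_perm Gamma h \in wreath G H.
Proof.
by move=> Hh; apply: (subsetP (joing_subr _ _)); apply: mem_morphim; rewrite ?inE.
Qed.

Variable Sigma : {set {set Gamma * Delta}}.
Hypothesis Sigma_inv : invariant_partition (wreath G H) Sigma.

Lemma mem_part x : exists2 S, S \in Sigma & x \in S.
Proof.
have [/and3P[/eqP cov _ _] _] := Sigma_inv.
by apply/bigcupP; rewrite -/(cover _) cov inE.
Qed.

Lemma part_eq S S' x :
  S \in Sigma -> S' \in Sigma -> x \in S -> x \in S' -> S = S'.
Proof.
have [/and3P[_ tI _] _] := Sigma_inv => SS SS' Sx S'x.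
by rewrite -(def_pblock tI SS Sx) (def_pblock tI SS' S'x).
Qed.

Lemma part_image u S : u \in wreath G H -> S \in Sigma -> u @: S \in Sigma.
Proof. by have [_ act] := Sigma_inv => Wu SS; rewrite -(acts_act act Wu) in SS. Qed.

(** The point [y], which lies over another coordinate, is fixed by the copy of
    [G] acting on the fibre of [x]; this pins [S] down as a set while [G] moves
    [x] to any other point of its fibre. *)
Lemma fibre_sub_mixed_part S x y :
    [transitive G, on [set: Gamma] | 'P] ->
    S \in Sigma -> x \in S -> y \in S -> x.2 != y.2 ->
  fibre Gamma x.2 \subset S.
Proof.
move=> G_trans SS Sx Sy xy; apply/subsetP => z; rewrite in_fibre => /eqP zx.
have [g Gg zg] := atransP2 G_trans (in_setT x.1) (in_setT z.1).
pose u := base_perm x.2 g.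
have uy : u y = y by rewrite permE /base_fun eq_sym (negPf xy).
have ux : u x = z by rewrite permE /base_fun eqxx [z]surjective_pairing zx zg.
have uS : u @: S \in Sigma by rewrite part_image ?base_perm_wreath.
have uSy : y \in u @: S by rewrite -uy imset_f.
by rewrite (part_eq SS uS Sy uSy) -ux imset_f.
Qed.

(** The top group carries the single fibre inside [S] to all the others, and it
    carries [S] to the parts that contain them. *)
Lemma fibre_sub_part i S S' x :
    [transitive H, on [set: Delta] | 'P] ->
    S \in Sigma -> fibre Gamma i \subset S -> S' \in Sigma -> x \in S' ->
  fibre Gamma x.2 \subset S'.
Proof.
move=> H_trans SS /subsetP iS SS' S'x.
have [h Hh xh] := atransP2 H_trans (in_setT i) (in_setT x.2).
pose u := top_perm Gamma h.
have uS : u @: S \in Sigma by rewrite part_image ?top_perm_wreath.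
have in_uS z : z.2 = x.2 -> z \in u @: S.
  move=> zx; apply/imsetP; exists (z.1, i); first by rewrite iS ?in_fibre.
  by rewrite permE /top_fun /= [z]surjective_pairing zx xh.
apply/subsetP => z; rewrite in_fibre => /eqP zx.
by rewrite (part_eq SS' uS S'x (in_uS x erefl)) in_uS.
Qed.

End WreathParts.

Theorem proposition2p12 (Gamma Delta : finType)
    (G : {group {perm Gamma}}) (H : {group {perm Delta}})
    (G_trans : [transitive G, on [set: Gamma] | 'P])
    (H_trans : [transitive H, on [set: Delta] | 'P])
    (Sigma : {set {set Gamma * Delta}})
    (Sigma_inv : invariant_partition (wreath G H) Sigma) :
  refines Sigma (canonical_partition Gamma Delta) \/
  refines (canonical_partition Gamma Delta) Sigma.
Proof.
have [/exists_inP[S SS /exists_inP[x Sx /exists_inP[y Sy xy]]] | pure] :=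
  boolP [exists S in Sigma, exists x in S, exists y in S, x.2 != y.2].
  right; apply: refinesP => S' z SS' S'z.
  have xS := fibre_sub_mixed_part Sigma_inv G_trans SS Sx Sy xy.
  exists (fibre Gamma z.2); split; first by rewrite imset_f.
    by rewrite in_fibre.
  exact: (fibre_sub_part Sigma_inv H_trans SS xS).
left; apply: refinesP => _ x /imsetP[d _ ->]; rewrite in_fibre => /eqP xd.
have [S SS Sx] := mem_part Sigma_inv x; exists S; split=> //.
apply/subsetP => y Sy; rewrite in_fibre -xd; apply: contraR pure => yx.
apply/exists_inP; exists S => //; apply/exists_inP; exists y => //.
by apply/exists_inP; exists x.
Qed.
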